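(* Let $(\Omega,\mu,d)$ be a metric measure space, let $J\ge 0$ be a function (kernel) on $\Omega\times\Omega$, viewed as a map $x\mapsto J(x,\cdot)$, and let $K_Ju(x)=\int_\Omega J(x,y)u(y)\,dy$. (i) Assume $1\le p,q\le\infty$ and $J\in L^q(\Omega,L^{p'}(\Omega))$. Then $K_J\in\mathcal L(L^p(\Omega),L^q(\Omega))$, the mapping $J\mapsto K_J$ is linear and continuous, and $$\|K_J\|_{\mathcal L(L^p(\Omega),L^q(\Omega))}\le\|J\|_{L^q(\Omega,L^{p'}(\Omega))}.$$ (ii) Assume $1\le p\le\infty$, $J\in L^\infty(\Omega,L^{p'}(\Omega))$, and that for any measurable set $D\subset\Omega$ with $\mu(D)<\infty$, $$\lim_{x\to x_0}\int_D J(x,y)\,dy=\int_D J(x_0,y)\,dy\qquad\text{for all }x_0\in\Omega.$$ Then $K_J\in\mathcal L(L^p(\Omega),\mathcal C_b(\Omega))$, the mapping $J\mapsto K_J$ is linear and continuous, and $$\|K_J\|_{\mathcal L(L^p(\Omega),\mathcal C_b(\Omega))}\le\|J\|_{L^\infty(\Omega,L^{p'}(\Omega))}.$$ In particular, if $J\in\mathcal C_b(\Omega,L^{p'}(\Omega))$, then $K_J\in\mathcal L(L^p(\Omega),\mathcal C_b(\Omega))$ and $\|K_J\|_{\mathcal L(L^p(\Omega),\mathcal C_b(\Omega))}\le\|J\|_{\mathcal C_b(\Omega,L^{p'}(\Omega))}$. (iii) Assume $\Omega\subset\mathbb R^N$ is open, $1\le p,q\le\infty$ and $J\in W^{1,q}(\Omega,L^{p'}(\Omega))$.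 Then $K_J\in\mathcal L(L^p(\Omega),W^{1,q}(\Omega))$, the mapping $J\mapsto K_J$ is linear and continuous, and $$\|K_J\|_{\mathcal L(L^p(\Omega),W^{1,q}(\Omega))}\le\|J\|_{W^{1,q}(\Omega,L^{p'}(\Omega))}.$$
   Context: A metric measure space $(\Omega,\mu,d)$ is a metric space $(\Omega,d)$ with a $\sigma$-finite, regular, complete Borel measure $\mu$ that associates a finite positive measure to the balls of $\Omega$. Integration $dy$ is with respect to $\mu$. For $1\le p\le\infty$, $p'$ is the conjugate exponent, $1/p+1/p'=1$. $\mathcal C_b(\Omega)$ is the space of bounded continuous functions with the sup norm. $\mathcal L(X,Y)$ is the space of bounded linear operators from $X$ to $Y$. $L^q(\Omega,Z)$, $\mathcal C_b(\Omega,Z)$, $W^{1,q}(\Omega,Z)$ denote the corresponding spaces of $Z$-valued functions, and $J$ is identified with the map $x\mapsto J(x,\cdot)$. When $\Omega\subset\mathbb R^N$ is open, it carries Lebesgue measure and the Euclidean metric.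
   Formalization: In (ii) with p = ∞ the limit condition is required for all measurable D, not only those with μ(D) < ∞; as printed it fails for Ω = ℝ, J(x,y) = φ(y − 1/x), J(0,·) = 0 (φ ≥ 0 a bump), u = sin. The ''in particular'' clause is proved for all p. *)

(* Defs.v *)
From HB Require Import structures.
From mathcomp Require Import all_boot all_order all_algebra.
From mathcomp Require Import all_classical all_reals all_analysis.

Set Implicit Arguments.
Unset Strict Implicit.
Unset Printing Implicit Defensive.

Import Order.TTheory GRing.Theory Num.Theory.
Import numFieldNormedType.Exports.

Local Open Scope classical_set_scope.
Local Open Scope ring_scope.

#[short(type="metricMeasurableType")]
HB.structure Definition MetricMeasurable (R : realType) (d : measure_display) :=
  {T of Metric R T & Measurable d T}.

(* Regularity is inner regularity by compact sets and outer regularity by open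
   sets, for every measurable set. *)
Record metric_measure (R : realType) (d : measure_display)
    (T : metricMeasurableType R d) (mu : {measure set T -> \bar R}) : Prop := {
  mm_borel : forall U : set T, open U -> measurable U ;
  mm_complete : measure_is_complete mu ;
  mm_sigma_finite : sigma_finite [set: T] mu ;
  mm_outer_regular : forall A : set T, measurable A ->
    mu A = ereal_inf [set mu U | U in [set U | open U /\ A `<=` U]] ;
  mm_inner_regular : forall A : set T, measurable A ->
    mu A = ereal_sup [set mu K | K in [set K | compact K /\ K `<=` A]] ;
  mm_ball : forall (x : T) (r : R), 0 < r -> (0 < mu (ball x r) < +oo)%E }.

(* A space of functions taken modulo functions of norm zero: the elements are
   the vectors satisfying [carrier], two of them being identified when the norm
   of their difference is 0.  [snorm] is only meaningful on [carrier]. *)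
Record nspace (R : realType) (V : lmodType R) := NSpace {
  carrier : set V ;
  snorm : V -> \bar R }.

Section Operators.
Context {R : realType}.
Local Open Scope ereal_scope.

Definition linear_on (V W : lmodType R) (X : nspace V) (Y : nspace W)
    (K : V -> W) : Prop :=
  forall (a : R) (u v : V), carrier X u -> carrier X v ->
    snorm Y (K (a *: u + v) - (a *: K u + K v))%R = 0.

Definition bounded_linear (V W : lmodType R) (X : nspace V) (Y : nspace W)
    (K : V -> W) : Prop :=
  [/\ forall u, carrier X u -> carrier Y (K u),
      linear_on X Y K &
      exists C : R, forall u, carrier X u -> snorm Y (K u) <= C%:E * snorm X u].

Definition opnorm (V W : lmodType R) (X : nspace V) (Y : nspace W)
    (K : V -> W) : \bar R :=
  ereal_sup [set snorm Y (K u) | u in [set u | carrier X u /\ snorm X u <= 1]].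

Definition bounded_operators (V W : lmodType R) (X : nspace V)
    (Y : nspace W) : nspace (V -> W) :=
  NSpace (bounded_linear X Y) (opnorm X Y).

Definition continuous_linear_map (V W : lmodType R) (X : nspace V)
    (Y : nspace W) (F : V -> W) : Prop :=
  [/\ forall u, carrier X u -> carrier Y (F u),
      linear_on X Y F &
      forall u, carrier X u -> forall e : R, (0 < e)%R ->
        exists2 r : R, (0 < r)%R &
          forall v, carrier X v -> snorm X (v - u)%R < r%:E ->
            snorm Y (F v - F u)%R < e%:E].

End Operators.

Section FunctionSpaces.
Context {R : realType} {d : measure_display} {T : metricMeasurableType R d}.
Variable mu : {measure set T -> \bar R}.

Definition lebesgue_space (p : \bar R) : nspace (T -> R) :=
  NSpace [set f : T -> R | f \in Lfun mu p]
         (fun f => Lnorm mu p (EFin \o f)).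

Definition Cb_space : nspace (T -> R) :=
  NSpace [set f : T -> R | continuous f /\ bounded_fun f]
         (fun f => ereal_sup [set `|f x|%:E | x in [set: T]]).

Section VectorValued.
Context {V : lmodType R}.
Variable Z : nspace V.

Definition simple_function (s : T -> V) : Prop :=
  [/\ finite_set (range s), forall v, measurable (s @^-1` [set v]) &
      forall x, carrier Z (s x)].

Definition strongly_measurable (f : T -> V) : Prop :=
  exists2 s : (T -> V)^nat, (forall n, simple_function (s n)) &
    {ae mu, forall x, snorm Z (s n x - f x) @[n --> \oo] --> 0%E}.

Definition bochner_space (q : \bar R) : nspace (T -> V) :=
  NSpace [set f : T -> V | [/\ forall x, carrier Z (f x),
            strongly_measurable f &
            (Lnorm mu q (fun x => snorm Z (f x)) < +oo)%E]]
         (fun f => Lnorm mu q (fun x => snorm Z (f x))).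

Definition simple_integral (s : T -> V) : V :=
  \sum_(v \in range s) fine (mu (s @^-1` [set v])) *: v.

(* [I] is the Bochner integral of [f]. *)
Definition is_bochner_integral (f : T -> V) (I : V) : Prop :=
  [/\ strongly_measurable f, carrier Z I &
    exists s : (T -> V)^nat,
    [/\ forall n, simple_function (s n),
        forall n v, v != 0 -> (mu (s n @^-1` [set v]) < +oo)%E,
        (\int[mu]_x snorm Z (f x - s n x))%E @[n --> \oo] --> 0%E &
        snorm Z (simple_integral (s n) - I) @[n --> \oo] --> 0%E]].

Definition Cb_vspace : nspace (T -> V) :=
  NSpace [set f : T -> V | [/\ forall x, carrier Z (f x),
            forall x0, snorm Z (f x - f x0) @[x --> x0] --> 0%E &
            exists C : R, forall x, (snorm Z (f x) <= C%:E)%E]]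
         (fun f => ereal_sup [set snorm Z (f x) | x in [set: T]]).

End VectorValued.

Definition integral_operator (J : T -> T -> R) (u : T -> R) : T -> R :=
  fun x => \int[mu]_y (J x y * u y).

(* The kernels in L^oo(Omega, L^p') for which x |-> \int_D J(x, y) dy is
   continuous for all test sets D.  The test sets are those of finite measure;
   for p = +oo on a space of infinite measure these do not suffice (take
   J(x, y) = phi(y - 1/x), J(0, y) = 0 on the real line, with phi a bump), and
   then D ranges over all measurable sets. *)
Definition continuous_kernel_space (p : \bar R) : nspace (T -> T -> R) :=
  let L := bochner_space (lebesgue_space (hoelder_conjugate p)) +oo%E in
  NSpace [set J : T -> T -> R | carrier L J /\
            forall D : set T, measurable D -> (mu D < +oo)%E \/ p = +oo%E ->
            forall x0 : T,
              \int[mu]_(y in D) J x y @[x --> x0] -->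
              \int[mu]_(y in D) J x0 y]
         (snorm L).

End FunctionSpaces.

Section Euclidean.
Context {R : realType} {N : nat}.

Definition box (a b : 'rV[R]_N) : set 'rV[R]_N :=
  [set x | forall i, a 0 i < x 0 i <= b 0 i].

Definition box_covers (A : set 'rV[R]_N) : set (nat -> 'rV[R]_N * 'rV[R]_N) :=
  [set ab : nat -> 'rV[R]_N * 'rV[R]_N |
     (forall k i, (ab k).1 0 i <= (ab k).2 0 i) /\
     A `<=` \bigcup_k box (ab k).1 (ab k).2].

Definition lebesgue_outer (A : set 'rV[R]_N) : \bar R :=
  ereal_inf
    [set (\sum_(0 <= k <oo) (\prod_i ((ab k).2 0 i - (ab k).1 0 i))%:E)%E
    | ab in box_covers A].

(* (T, mu) is the open set Omega of R^N, with the Euclidean distance and the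
   (complete) Lebesgue measure; [iota] is the inclusion map. *)
Record open_euclidean (d : measure_display) (T : metricMeasurableType R d)
    (mu : {measure set T -> \bar R}) (Omega : set 'rV[R]_N)
    (iota : T -> 'rV[R]_N) : Prop := {
  oe_open : open Omega ;
  oe_range : range iota = Omega ;
  oe_dist : forall x y : T,
    mdist x y = Num.sqrt (\sum_i (iota x 0 i - iota y 0 i) ^+ 2) ;
  oe_measurable : forall A : set T,
    measurable A <-> lebesgue_outer.-caratheodory (iota @` A) ;
  oe_measure : forall A : set T, measurable A ->
    mu A = lebesgue_outer (iota @` A) }.

Definition partial (i : 'I_N) (phi : 'rV[R]_N -> R) : 'rV[R]_N -> R :=
  fun x => 'D_(delta_mx 0 i) phi x.

Definition smooth (phi : 'rV[R]_N -> R) : Prop :=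
  forall s : seq 'I_N, let psi := foldr partial phi s in
    continuous psi /\ forall i x, derivable psi x (delta_mx 0 i).

Definition test_function (Omega : set 'rV[R]_N) (phi : 'rV[R]_N -> R) : Prop :=
  [/\ smooth phi, compact (closure [set x | phi x != 0]) &
      closure [set x | phi x != 0] `<=` Omega].

End Euclidean.

Section Sobolev.
Context {R : realType} {d : measure_display} {T : metricMeasurableType R d}.
Variable mu : {measure set T -> \bar R}.
Context {N : nat}.
Variables (Omega : set 'rV[R]_N) (iota : T -> 'rV[R]_N).

Definition weak_partial (i : 'I_N) (f g : T -> R) : Prop :=
  forall phi, test_function Omega phi ->
    \int[mu]_x (f x * partial i phi (iota x)) =
    - \int[mu]_x (g x * phi (iota x)).

Definition weak_vpartial (V : lmodType R) (Z : nspace V) (i : 'I_N)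
    (f g : T -> V) : Prop :=
  forall phi, test_function Omega phi -> exists I : V,
    is_bochner_integral mu Z (fun x => partial i phi (iota x) *: f x) I /\
    is_bochner_integral mu Z (fun x => phi (iota x) *: g x) (- I).

(* The norm is ||f|| + \sum_i ||d_i f||.  As d_i f is only a function up to
   null sets, its norm is written as an infimum over the functions g
   representing it, all of which have the same norm. *)
Definition sobolev_over (V : lmodType R) (L : nspace (T -> V))
    (is_partial : 'I_N -> (T -> V) -> (T -> V) -> Prop) : nspace (T -> V) :=
  NSpace [set f | carrier L f /\
            forall i, exists2 g, carrier L g & is_partial i f g]
         (fun f => snorm L f + \sum_(i < N) ereal_inf
            [set snorm L g | g in [set g | carrier L g /\ is_partial i f g]])%E.

Definition sobolev_space (q : \bar R) : nspace (T -> R) :=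
  sobolev_over (lebesgue_space mu q) weak_partial.

Definition sobolev_vspace (V : lmodType R) (Z : nspace V) (q : \bar R) :
    nspace (T -> V) :=
  sobolev_over (bochner_space mu Z q) (weak_vpartial Z).

End Sobolev.

(* Main.v *)
Require Import Defs.
From mathcomp Require Import all_boot all_order all_algebra.
From mathcomp Require Import finmap ring.
From mathcomp Require Import all_classical all_reals all_analysis.
From mathcomp Require Import measurable_realfun ess_sup_inf.

(** For every [x] the value [integral_operator mu J u x] is the duality bracket
    [pairing mu u (J x)] of [u] in $L^p$ with [J x] in $L^{p'}$.  Hoelder's
    inequality bounds it by $\|J(x,\cdot)\|_{p'}\|u\|_p$, and it is bilinear in
    [(J, u)].  Each bound on the operator norm is obtained by taking a norm in
    [x] of this pointwise inequality; as the bound holds for all kernels, with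
    constant one, applying it to [J' - J] also gives the continuity of
    [J |-> K_J] ([integral_operator_continuous_linear]).  What remains is to
    show that [K_J u] belongs to the target space.

    Target $L^q$: [J] is an almost everywhere limit of simple functions, and a
    Lipschitz functional composed with [J] is the limit of the same functional
    composed with these; as [mu] is complete it is measurable
    ([strongly_measurable_comp]).  This applies to [pairing mu u] and to the
    norm of $L^{p'}$.

    Target $C_b$: by the hypothesis on [J], [K_J u] is continuous when [u] is
    the indicator of a test set, hence when [u] is a combination of such
    indicators, and these are dense in $L^p$ ([Lfun_density]).  The bound of
    $\|J(x,\cdot)\|_{p'}$ by the essential supremum holds only for almost every
    [x]; but balls have positive measure, so the resulting bound on a continuous
    [K_J u] holds at every point ([ae_le_continuous]).  By density the bound
    extends to all [u] ([kernel_image_le]), so that [K_J u] is a uniform limit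
    of continuous functions ([kernel_image_continuous]).  If instead
    [x |-> J x] is continuous into $L^{p'}$, Hoelder's inequality for
    [J x - J x0] suffices.

    Target $W^{1,q}$: a continuous linear functional commutes with the Bochner
    integral ([bochner_integral_pairing]), so [pairing mu u] carries the
    identity that defines a weak derivative [G] of [J] to the one that makes
    [K_G u] a weak derivative of [K_J u].  The first case then bounds [K_J u]
    and each [K_G u]. *)

Set Implicit Arguments.
Unset Strict Implicit.
Unset Printing Implicit Defensive.

Import Order.TTheory GRing.Theory Num.Theory.
Import numFieldNormedType.Exports.
Import HBSimple HBNNSimple.

Local Open Scope classical_set_scope.
Local Open Scope ring_scope.

(** * Lebesgue spaces and the duality bracket *)

Section LebesgueSpaces.
Context d (T : measurableType d) (R : realType).
Variable mu : {measure set T -> \bar R}.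
Implicit Types (p q : \bar R) (u v : T -> R).

Local Notation "'N_ p u" := (Lnorm mu p (EFin \o u%R))
  (at level 10, p at level 2, u at level 9).

Lemma LfunE p u :
  u \in Lfun mu p <-> measurable_fun setT u /\ ('N_p u < +oo)%E.
Proof.
split.
  by move/andP=> [+ +]; rewrite !inE /finite_norm /=.
by move=> [mu' fu]; apply/andP; split; rewrite inE.
Qed.

Lemma Lfun_measurable p u : u \in Lfun mu p -> measurable_fun setT u.
Proof. by case/LfunE. Qed.

Lemma Lfun_lty p u : u \in Lfun mu p -> ('N_p u < +oo)%E.
Proof. by case/LfunE. Qed.

Lemma Lfun_fin_num p u : u \in Lfun mu p -> 'N_p u \is a fin_num.
Proof. by move=> up; rewrite ge0_fin_numE ?Lnorm_ge0// (Lfun_lty up). Qed.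

Lemma Lfun_lincomb p a u v : (1 <= p)%E ->
  u \in Lfun mu p -> v \in Lfun mu p -> a *: u + v \in Lfun mu p.
Proof. by move=> p1; have [_] := Lfun_submod_closed mu p1; apply. Qed.

Lemma Lfun0 p : (1 <= p)%E -> 0 \in Lfun mu p.
Proof. by move=> p1; have [] := Lfun_submod_closed mu p1. Qed.

Lemma LfunD p u v : (1 <= p)%E ->
  u \in Lfun mu p -> v \in Lfun mu p -> u + v \in Lfun mu p.
Proof. by move=> p1; rewrite -{2}[u]scale1r; exact: Lfun_lincomb. Qed.

Lemma LfunZ p a u : (1 <= p)%E -> u \in Lfun mu p -> a *: u \in Lfun mu p.
Proof.
by move=> p1 up; rewrite -[_ *: _]addr0; apply: Lfun_lincomb => //; exact: Lfun0.
Qed.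

Lemma LfunB p u v : (1 <= p)%E ->
  u \in Lfun mu p -> v \in Lfun mu p -> u - v \in Lfun mu p.
Proof. by move=> p1 up vp; apply: LfunD => //; rewrite -scaleN1r; exact: LfunZ. Qed.

Lemma Lnorm_scale p a u : (1 <= p)%E -> u \in Lfun mu p ->
  'N_p (a *: u) = (`|a|%:E * 'N_p u)%E.
Proof. by move=> p1 up; have := LnormZ (Lfun_Sub p1 up) a. Qed.

Lemma LnormN p u : 'N_p (- u) = 'N_p u.
Proof. exact: oppe_Lnorm mu (EFin \o u) p. Qed.

Lemma LnormBC p u v : 'N_p (u - v) = 'N_p (v - u).
Proof. by rewrite -LnormN opprB. Qed.

Lemma Lnorm_triangle p u v : (1 <= p)%E ->
  u \in Lfun mu p -> v \in Lfun mu p -> ('N_p (u + v) <= 'N_p u + 'N_p v)%E.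
Proof. by move=> p1 /Lfun_measurable ? /Lfun_measurable ?; exact: eminkowski. Qed.

Lemma Lnorm_zero p : (1 <= p)%E -> 'N_p (0 : T -> R) = 0%E.
Proof. by move=> p1; apply: Lnorm0; rewrite gt_eqF// (lt_le_trans _ p1). Qed.

Lemma Lnormy_ae u : {ae mu, forall x, (`|u x|%:E <= 'N_(+oo%E) u)%E}.
Proof.
rewrite unlock; case: ifPn => [_|]; first exact: ess_sup_ge.
rewrite -leNgt => mu0; exists setT; split => //.
by apply/eqP; rewrite eq_le mu0 measure_ge0.
Qed.

Lemma le_Lnorm p (f g : T -> \bar R) : (1 <= p)%E ->
  measurable_fun setT f -> measurable_fun setT g ->
  (forall x, (`|f x| <= `|g x|)%E) -> (Lnorm mu p f <= Lnorm mu p g)%E.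
Proof.
move=> p1 mf mg fg; rewrite unlock; case: p p1 => [r|_|//].
- rewrite lee_fin => r1; have r0 : 0 < r by exact: lt_le_trans r1.
  have mpow (h : T -> \bar R) : measurable_fun setT h ->
      measurable_fun setT (fun x => `|h x| `^ r)%E.
    move=> mh; apply: (@measurableT_comp _ _ _ _ _ _ (fun x => x `^ r)%E) => //=.
      exact: measurable_poweR.
    exact: measurableT_comp.
  have le_pow (x y : \bar R) (s : R) : (0 <= s)%R -> (0 <= x)%E -> (x <= y)%E ->
      (x `^ s <= y `^ s)%E.
    move=> s0 x0 xy; apply: gt0_ler_poweR; rewrite ?s0// in_itv /= leey ?x0 //.
    by rewrite (le_trans x0 xy).
  apply: (le_pow _ _ _); rewrite ?invr_ge0 ?(ltW r0)//.
    by apply: integral_ge0 => x _; exact: poweR_ge0.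
  apply: ge0_le_integral => //=;
    [by move=> x _; exact: poweR_ge0|exact: mpow|exact: mpow|].
  by move=> x _; apply: le_pow; rewrite ?(ltW r0).
- case: ifPn => // _; apply: le_ess_sup; exact: nearW.
Qed.

Lemma Lnorm_integral1 u : 'N_1 u = (\int[mu]_x `|u x|%:E)%E.
Proof. exact: Lnorm1. Qed.

Let hoelder_1y u v : u \in Lfun mu 1%E -> v \in Lfun mu +oo%E ->
  (\int[mu]_y `|u y * v y|%:E <= 'N_1 u * 'N_(+oo%E) v)%E.
Proof.
move=> u1 vy; have mU := Lfun_measurable u1; have mV := Lfun_measurable vy.
have vfin := Lfun_fin_num vy.
have mabs (w : T -> R) : measurable_fun setT w ->
    measurable_fun setT (fun y => `|w y|%:E).
  by move=> mw; apply/measurable_EFinP; exact: measurableT_comp.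
rewrite Lnorm_integral1 -ge0_integralZr//; [|exact: mabs|exact: Lnorm_ge0].
apply: ae_ge0_le_integral => //.
- by apply: mabs; exact: measurable_funM.
- by move=> x _; rewrite mule_ge0// Lnorm_ge0.
- by apply: emeasurable_funM => //; exact: mabs.
- apply: filterS (Lnormy_ae v) => x vx _.
  by rewrite normrM EFinM lee_wpmul2l.
Qed.

(** At the endpoints [p = 1] and [p = +oo] one of the two factors is almost
    everywhere bounded by its norm; in between this is the usual inequality for
    real exponents. *)
Lemma hoelder_conj p u v : (1 <= p)%E ->
  u \in Lfun mu p -> v \in Lfun mu (hoelder_conjugate p) ->
  (\int[mu]_y `|v y * u y|%:E <= 'N_(hoelder_conjugate p) v * 'N_p u)%E.
Proof.
move=> p1 up vp; have := p1; rewrite le_eqVlt => /predU1P[p1E|p1'].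
  move: up vp; rewrite -p1E hoelder_conjugate1 => up vp.
  by rewrite muleC; under eq_integral do rewrite mulrC; exact: hoelder_1y.
case: p p1 up vp p1' => [r| |//] p1 up vp; last first.
  by move=> _; rewrite hoelder_conjugatey in vp *; exact: hoelder_1y.
rewrite lte_fin => r1; have r0 : 0 < r by rewrite (lt_trans _ r1).
have rE : hoelder_conjugate r%:E = (r / (r - 1))%:E.
  by rewrite /hoelder_conjugate /= eqe (gt_eqF r0) inver subr_eq0 gt_eqF.
rewrite rE in vp *.
have mU := Lfun_measurable up; have mV := Lfun_measurable vp.
have rB0 : 0 < r - 1 by rewrite subr_gt0.
have := @hoelder _ _ _ mu v u (r / (r - 1)) r mV mU.
rewrite Lnorm_integral1; apply => //; first by rewrite divr_gt0.
by rewrite invf_div mulrBl mul1r divff ?subrK // gt_eqF.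
Qed.

(** The duality bracket between $L^{p'}$ and $L^p$; the operator with kernel [J]
    is [x |-> pairing u (J x)]. *)
Definition pairing u v : R := \int[mu]_y (v y * u y).

Section Pairing.
Variables (p : \bar R) (p1 : (1 <= p)%E).
Local Notation p' := (hoelder_conjugate p).

Lemma pairing_integrable u v : u \in Lfun mu p -> v \in Lfun mu p' ->
  mu.-integrable setT (EFin \o (fun y => v y * u y)).
Proof.
move=> up vp; apply/integrableP; split.
  apply/measurable_EFinP/measurable_funM;
  [exact: Lfun_measurable vp|exact: Lfun_measurable up].
apply: le_lt_trans (hoelder_conj p1 up vp) _.
by rewrite lte_mul_pinfty ?Lnorm_ge0 ?(Lfun_fin_num vp) ?(Lfun_lty up).
Qed.

Lemma pairing_le u v : u \in Lfun mu p -> v \in Lfun mu p' ->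
  (`|pairing u v|%:E <= 'N_p' v * 'N_p u)%E.
Proof.
move=> up vp; apply: le_trans (hoelder_conj p1 up vp).
rewrite /pairing EFin_normr_Rintegral//; last exact: pairing_integrable.
apply: le_abse_integral => //.
exact: measurable_int (pairing_integrable up vp).
Qed.

Lemma pairing_fine_le u v : u \in Lfun mu p -> v \in Lfun mu p' ->
  `|pairing u v| <= fine ('N_p' v) * fine ('N_p u).
Proof.
move=> up vp; rewrite -lee_fin EFinM !fineK ?(Lfun_fin_num vp) ?(Lfun_fin_num up)//.
exact: pairing_le.
Qed.

Lemma pairing_lincombr u a v w : u \in Lfun mu p -> v \in Lfun mu p' ->
  w \in Lfun mu p' -> pairing u (a *: v + w) = a * pairing u v + pairing u w.
Proof.
move=> up vp wp; rewrite /pairing -RintegralZl//; last exact: pairing_integrable.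
rewrite -RintegralD//; last exact: pairing_integrable.
  by apply: eq_Rintegral => y _; rewrite !fctE mulrDl mulrA.
rewrite (_ : _ \o _ = fun y => (a%:E * (EFin \o (fun y => (v y * u y)%R)) y)%E) //.
by apply: integrableZl => //; exact: pairing_integrable.
Qed.

Lemma pairing_lincombl v a u w : u \in Lfun mu p -> w \in Lfun mu p ->
  v \in Lfun mu p' -> pairing (a *: u + w) v = a * pairing u v + pairing w v.
Proof.
move=> up wp vp; rewrite /pairing -RintegralZl//; last exact: pairing_integrable.
rewrite -RintegralD//; last exact: pairing_integrable.
  by apply: eq_Rintegral => y _; rewrite !fctE mulrDr mulrCA.
rewrite (_ : _ \o _ = fun y => (a%:E * (EFin \o (fun y => (v y * u y)%R)) y)%E) //.
by apply: integrableZl => //; exact: pairing_integrable.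
Qed.

Lemma pairingr0 u : pairing u 0 = 0.
Proof.
by rewrite /pairing; under eq_Rintegral do rewrite mul0r; rewrite /Rintegral integral0.
Qed.

Lemma pairingZr a u v : u \in Lfun mu p -> v \in Lfun mu p' ->
  pairing u (a *: v) = a * pairing u v.
Proof.
move=> up vp; rewrite -[a *: v]addr0 pairing_lincombr// ?pairingr0 ?addr0//.
exact/Lfun0/hoelder_conj_ge1.
Qed.

Lemma pairingBr u v w : u \in Lfun mu p -> v \in Lfun mu p' ->
  w \in Lfun mu p' -> pairing u (v - w) = pairing u v - pairing u w.
Proof.
move=> up vp wp; rewrite addrC -scaleN1r pairing_lincombr//.
by rewrite mulN1r addrC.
Qed.

Lemma pairingBl v u w : u \in Lfun mu p -> w \in Lfun mu p ->
  v \in Lfun mu p' -> pairing (u - w) v = pairing u v - pairing w v.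
Proof.
move=> up wp vp; rewrite addrC -scaleN1r pairing_lincombl//.
by rewrite mulN1r addrC.
Qed.

End Pairing.
End LebesgueSpaces.

(** * Density in Lebesgue spaces *)

Section Density.
Context d (T : measurableType d) (R : realType).
Variable mu : {measure set T -> \bar R}.
Local Notation "'N_ p u" := (Lnorm mu p (EFin \o u%R))
  (at level 10, p at level 2, u at level 9).

Lemma Lnormy_le (u : T -> R) (e : R) : 0 <= e ->
  {ae mu, forall x, `|u x| <= e} -> ('N_(+oo%E) u <= e%:E)%E.
Proof.
move=> e0 ue; rewrite unlock; case: ifPn => [_|_]; last by rewrite lee_fin.
by apply/ess_supP; apply: filterS ue => x; rewrite /= lee_fin.
Qed.

Lemma Lfun_dominated p (u v : T -> R) : (1 <= p)%E -> measurable_fun setT u ->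
  v \in Lfun mu p -> (forall x, `|u x| <= `|v x|) -> u \in Lfun mu p.
Proof.
move=> p1 um vp uv; apply/LfunE; split => //.
apply: le_lt_trans (Lfun_lty vp); apply: le_Lnorm => //.
- exact/measurable_EFinP.
- exact/measurable_EFinP/(Lfun_measurable vp).
Qed.

Lemma indic_Lfun p (D : set T) : (1 <= p)%E -> measurable D ->
  (mu D < +oo)%E \/ p = +oo%E <-> \1_D \in Lfun mu p.
Proof.
move=> p1 mD; have m1 : measurable_fun setT (\1_D : T -> R) by [].
case: p p1 => [r| |//] p1; last first.
  split => [_|_]; last by right.
  apply/LfunE; split => //; apply: (@le_lt_trans _ _ 1%:E); last exact: ltry.
  apply: Lnormy_le => //; apply: aeW => x.
  by rewrite indicE; case: (x \in D); rewrite ?normr1 ?normr0.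
have r1 : 1 <= r by rewrite -lee_fin.
have r0 : 0 < r by exact: lt_le_trans r1.
have E : (\int[mu]_x (`|\1_D x| `^ r)%:E = mu D)%E.
  rewrite -[in RHS](setIT D) -integral_indic//; apply: eq_integral => x _.
  by rewrite indicE; case: (x \in D); rewrite ?normr1 ?normr0 ?powR1 ?powR0// gt_eqF.
split => [[Dfin|//]|/(Lfun_integrable r1)/integrableP[_]].
  apply/LfunE; split => //; rewrite unlock.
  by under eq_integral do rewrite /= ; rewrite poweR_lty// E.
by under eq_integral do rewrite gee0_abs ?lee_fin ?powR_ge0//; rewrite E; left.
Qed.

Section Principle.
Variables (p : \bar R) (p1 : (1 <= p)%E) (P : (T -> R) -> Prop).
Hypothesis P0 : P 0.
Hypothesis P_indic : forall D, measurable D -> \1_D \in Lfun mu p -> P \1_D.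
Hypothesis P_lincomb : forall a u v, u \in Lfun mu p -> v \in Lfun mu p ->
  P u -> P v -> P (a *: u + v).

Let close (u : T -> R) (e : R) :=
  exists h, [/\ h \in Lfun mu p, P h & ('N_p (u - h) <= e%:E)%E].

(** For [v != 0] the indicator of [h @^-1` [set v]] is dominated by [v^-1 *: h],
    hence in $L^p$; the level set of [0] may have infinite measure, but its
    coefficient vanishes. *)
Let finite_range_P (h : {nnsfun T >-> R}) : (h : T -> R) \in Lfun mu p -> P h.
Proof.
move=> hp.
have term (v : R) : v *: \1_(h @^-1` [set v]) \in Lfun mu p /\
    P (v *: \1_(h @^-1` [set v])).
  have [->|v0] := eqVneq v 0.
    by rewrite scale0r; split => //; exact: Lfun0.
  have i1 : \1_(h @^-1` [set v]) \in Lfun mu p.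
    apply: (Lfun_dominated p1 _ (LfunZ v^-1 p1 hp)) => // x.
    rewrite indicE; have [|_] := boolP (_ \in _); last by rewrite normr0.
    rewrite inE /= => hx; change (`|1 : R| <= `|v^-1 * h x|).
    by rewrite hx mulVf.
  split; first exact: LfunZ.
  by rewrite -[_ *: _]addr0; apply: P_lincomb => //; [exact: Lfun0|exact: P_indic].
have -> : (h : T -> R) =
    \sum_(v <- fset_set (range h)) v *: \1_(h @^-1` [set v]).
  by apply/funext => x; rewrite fct_sumE fimfunE fsbig_finite.
suff : (\sum_(v <- fset_set (range h)) v *: \1_(h @^-1` [set v]) \in Lfun mu p) /\
    P (\sum_(v <- fset_set (range h)) v *: \1_(h @^-1` [set v])) by case.
elim: (enum_fset _) => [|v s [IHp IHP]].
  by rewrite big_nil; split => //; exact: Lfun0.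
have [vp vP] := term v; rewrite big_cons -[v *: _]scale1r.
by split; [exact: Lfun_lincomb|exact: P_lincomb].
Qed.

(** The simple functions that increase to [u] converge to it in $L^r$ by
    dominated convergence, since [|u - h n|^r <= |u|^r]. *)
Let close_finite (u : T -> R) (r e : R) : p = r%:E -> 0 < e ->
  u \in Lfun mu p -> (forall x, 0 <= u x) -> close u e.
Proof.
move=> pr e0 up u0; have r1 : 1 <= r by rewrite -lee_fin -pr.
have r0 : 0 < r by exact: lt_le_trans r1.
have mu' := Lfun_measurable up.
have mEu : measurable_fun setT (EFin \o u) by exact/measurable_EFinP.
pose h := nnsfun_approx measurableT mEu.
have hle n x : h n x <= u x.
  rewrite -lee_fin /h nnsfun_approxE.
  exact: (@le_approx _ _ _ setT (EFin \o u) n x (fun x _ => u0 x) I).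
have hcv x : h n x @[n --> \oo] --> u x.
  have := @cvg_nnsfun_approx _ _ _ _ measurableT _ mEu (fun x _ => u0 x) x I.
  by move/fine_cvgP => [_].
have h0 n x : 0 <= h n x by [].
have hp n : (h n : T -> R) \in Lfun mu p.
  by apply: (Lfun_dominated p1 _ up) => // x; rewrite !ger0_norm.
have mpow (f : T -> R) : measurable_fun setT f ->
    measurable_fun setT (fun x => (`|f x| `^ r)%:E).
  move=> mf; apply/measurable_EFinP.
  by apply: (measurableT_comp (measurable_powR _)) => //; exact: measurableT_comp.
have uint : mu.-integrable setT (fun x => (`|u x| `^ r)%:E).
  by apply: Lfun_integrable => //; rewrite -pr.
have mB n : measurable_fun setT (u \- h n) by exact: measurable_funB.
have cv0 : {ae mu, forall x, setT x ->
    (`|u x - h n x| `^ r)%:E @[n --> \oo] --> cst 0%E x}.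
  apply: aeW => x _; apply: cvg_EFin; first exact: nearW.
  apply/cvgrPdist_le => a a0; have ar0 : 0 < a `^ r^-1 by exact: powR_gt0.
  have /cvgrPdist_le/(_ _ ar0) := hcv x; apply: filterS => n /= un.
  rewrite sub0r normrN ger0_norm ?powR_ge0// -[leRHS]powRr1 ?(ltW a0)//.
  rewrite -(mulVf (lt0r_neq0 r0)) powRrM.
  by rewrite ge0_ler_powR ?nnegrE ?(ltW r0)// powR_ge0.
have le_u : {ae mu, forall x, forall n, setT x ->
    (`|(`|u x - h n x| `^ r)%:E| <= (`|u x| `^ r)%:E)%E}.
  apply: aeW => x n _; rewrite gee0_abs ?lee_fin ?powR_ge0//.
  rewrite ge0_ler_powR ?nnegrE ?(ltW r0)// ger0_norm ?subr_ge0//.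
  by rewrite ger0_norm// gerBl.
have [_ _] := dominated_convergence measurableT (fun n => mpow _ (mB n))
  (measurable_cst _) cv0 uint le_u.
rewrite integral0 => /fine_cvgP[Ifin /cvgrPdist_lt/(_ (e `^ r) (powR_gt0 r e0)) Icv].
have [n /=] : exists n, (\int[mu]_x (`|u x - h n x| `^ r)%:E <= (e `^ r)%:E)%E.
  near \oo => n; exists n.
  have finn : (\int[mu]_x (`|u x - h n x| `^ r)%:E)%E \is a fin_num by near: n.
  rewrite -(fineK finn) lee_fin (le_trans (ler_norm _))// ltW// -normrN -sub0r.
  by near: n.
move=> In; exists (h n); split => //; first exact: finite_range_P.
rewrite pr unlock -[e]powRr1 ?(ltW e0)// -(mulfV (lt0r_neq0 r0)) powRrM.
rewrite -poweR_EFin; apply: gt0_ler_poweR => //.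
- by rewrite invr_ge0 ltW.
- by rewrite in_itv/= leey integral_ge0.
- by rewrite in_itv/= leey lee_fin powR_ge0.
Unshelve. all: by end_near. Qed.

(** Subtracting [e] from [u] on the set [A] where [e <= u] keeps it nonnegative.
    On [A] the upper bound drops by [e], and off [A] the function is below [e];
    so the bound [m.+2%:R * e] becomes [m.+1%:R * e]. *)
Let greedy (e : R) (m : nat) (u : T -> R) : p = +oo%E -> 0 < e ->
  measurable_fun setT u -> (forall x, 0 <= u x <= m.+1%:R * e) ->
  exists h, [/\ h \in Lfun mu p, P h & forall x, `|u x - h x| <= e].
Proof.
move=> py e0; elim: m u => [|m IH] u mu' ub.
  exists 0; split => //; first exact: Lfun0.
  move=> x; have := ub x; rewrite mul1r => /andP[ux0 uxe].
  by rewrite [0 x]/(0 : R) subr0 ger0_norm.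
pose A := [set x | e <= u x].
have mA : measurable A.
  by rewrite -[A]setTI; exact: measurable_fun_le.
have A1 : \1_A \in Lfun mu p by apply/indic_Lfun => //; right.
have [h [hp hP uh]] : exists h, [/\ h \in Lfun mu p, P h &
    forall x, `|(u x - e * \1_A x) - h x| <= e].
  apply: IH.
    by apply: measurable_funB => //; exact: measurable_funM.
  move=> x; have /andP[ux0 ux] := ub x; rewrite indicE.
  have [|] := boolP (x \in A); rewrite ?inE ?notin_setE/= => Ax.
    by rewrite mulr1 subr_ge0 Ax/= lerBlDr -[X in _ + X]mul1r -mulrDl natr1.
  rewrite mulr0 subr0 ux0/=; move/negP: Ax; rewrite -ltNge => /ltW/le_trans; apply.
  by apply: ler_peMl; [exact: ltW|rewrite ler1n].
exists (e *: \1_A + h); split.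
- exact: Lfun_lincomb.
- by apply: P_lincomb => //; exact: P_indic.
- by move=> x; have := uh x; rewrite -addrA -opprD.
Qed.

(** [u] is bounded by its norm [M] only almost everywhere, so the uniform
    approximation applies to [u] set to [0] where it exceeds [M]. *)
Let close_infty (u : T -> R) (e : R) : p = +oo%E -> 0 < e ->
  u \in Lfun mu p -> (forall x, 0 <= u x) -> close u e.
Proof.
move=> py e0 up u0; have um := Lfun_measurable up.
rewrite py in up; have ufin := Lfun_fin_num up.
set M := fine ('N_(+oo%E) u).
pose A := [set x | u x <= M].
have mA : measurable A by rewrite -[A]setTI; exact: measurable_fun_le.
have [m mM] : exists m : nat, M <= m.+1%:R * e.
  exists (Num.truncn (M / e)).
  by rewrite -ler_pdivrMr// ltW// truncnS_gt.
have [] := @greedy e m (fun x => u x * \1_A x) py e0.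
- exact: measurable_funM.
- move=> x; rewrite indicE; have [|_] := boolP (x \in A).
    by rewrite inE mulr1 u0/= => /le_trans; apply.
  by rewrite mulr0 lexx/= mulr_ge0// ltW.
move=> h [hp hP uh]; exists h; split => //.
rewrite {1}py; apply: Lnormy_le; first exact: ltW.
apply: filterS (Lnormy_ae mu u) => x; rewrite -(fineK ufin) lee_fin ger0_norm// => uM.
by have := uh x; rewrite indicE mem_set// mulr1.
Qed.

(** A property that holds for the indicators in $L^p$ and is preserved by linear
    combinations holds on a dense subset of $L^p$.  For finite [p] this is the
    density of the simple functions; for [p = +oo] a bounded function is
    approximated uniformly by repeatedly subtracting [e] where it is at least
    [e]. *)
Lemma Lfun_density u (e : R) : 0 < e -> u \in Lfun mu p ->
  exists h, [/\ h \in Lfun mu p, P h & ('N_p (u - h) <= e%:E)%E].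
Proof.
move=> e0 up; have e20 : 0 < e / 2 by rewrite divr_gt0.
have um := Lfun_measurable up.
have pos (v : T -> R) : v \in Lfun mu p -> (forall x, 0 <= v x) -> close v (e / 2).
  case: (p) p1 (@close_finite) (@close_infty) => [r| |//] _ cf ci vp v0;
  [exact: (cf _ r)|exact: ci].
have [h [hp hP uh]] : close u^\+ (e / 2).
  apply: pos; last exact: funrpos_ge0.
  apply: (Lfun_dominated p1 _ up); first exact: measurable_funrpos.
  move=> x; rewrite ger0_norm ?funrpos_ge0// /funrpos ge_max normr_ge0 andbT.
  exact: ler_norm.
have [k [kp kP uk]] : close u^\- (e / 2).
  apply: pos; last exact: funrneg_ge0.
  apply: (Lfun_dominated p1 _ up); first exact: measurable_funrneg.
  move=> x; rewrite ger0_norm ?funrneg_ge0// /funrneg ge_max normr_ge0 andbT.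
  by rewrite -normrN; exact: ler_norm.
exists (h - k); split; first exact: LfunB.
  by rewrite addrC -scaleN1r; exact: P_lincomb.
have -> : u - (h - k) = (u^\+ - h) + (k - u^\-).
  by rewrite -{1}[u]funrposBneg opprB [k - h]addrC addrACA [- _ + k]addrC.
rewrite (splitr e) EFinD; apply: le_trans (leeD uh uk).
rewrite (LnormBC _ _ u^\-); apply: eminkowski => //.
- by apply: measurable_funB; [exact: measurable_funrpos|exact: Lfun_measurable hp].
- by apply: measurable_funB; [exact: Lfun_measurable kp|exact: measurable_funrneg].
Qed.

End Principle.
End Density.

(** * Strongly measurable functions *)

Section StrongMeasurability.
Context (R : realType) (d : measure_display) (T : metricMeasurableType R d).
Variable mu : {measure set T -> \bar R}.
Context (V : lmodType R).
Variable Z : nspace V.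

Lemma simple_function_preimage (s : T -> V) (B : set V) :
  simple_function Z s -> measurable (s @^-1` B).
Proof.
move=> [fs ms _]; rewrite (_ : _ @^-1` _ =
    \bigcup_(v in range s `&` B) (s @^-1` [set v])); last first.
  apply/seteqP; split => [x Bx|x [v [_ Bv]] /= ->//].
  by exists (s x) => //; split => //; exists x.
by apply: fin_bigcup_measurable => //; exact: finite_setIl.
Qed.

Lemma simple_function_comp (F : V -> R) (s : T -> V) :
  simple_function Z s -> measurable_fun setT (F \o s).
Proof.
by move=> ss _ B mB; rewrite setTI comp_preimage; exact: simple_function_preimage.
Qed.

(** [F \o f] is almost everywhere the limit of the measurable functions
    [F \o s n]; completeness of [mu] absorbs the exceptional null set [N], where
    the sequence may fail to converge. *)
Lemma strongly_measurable_comp (F : V -> R) (c : R) (f : T -> V) :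
  measure_is_complete mu ->
  (forall z w, carrier Z z -> carrier Z w ->
    (`|F z - F w|%:E <= c%:E * snorm Z (z - w)%R)%E) ->
  (forall x, carrier Z (f x)) -> strongly_measurable mu Z f ->
  measurable_fun setT (F \o f).
Proof.
move=> mu_c FL fZ [s ss [N [mN N0 sN]]].
have scvg x : ~ N x -> F (s n x) @[n --> \oo] --> F (f x).
  move=> Nx; have {Nx}sx : snorm Z (s n x - f x) @[n --> \oo] --> 0%E.
    by apply: contrapT => sx; apply/Nx/sN.
  apply/cvgrPdist_le => e e0.
  have : (c%:E * snorm Z (s n x - f x))%E @[n --> \oo] --> 0%E.
    by rewrite -[X in _ --> X](mule0 c%:E); exact: cvgeZl.
  move=> /fine_cvgP[fin_n] /cvgrPdist_le /(_ e e0) cvg_n.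
  near=> n.
  rewrite distrC -lee_fin; apply: le_trans (FL _ _ _ (fZ x)) _.
    by have [_ _] := ss n; apply.
  have finn : (c%:E * snorm Z (s n x - f x))%E \is a fin_num by near: n.
  rewrite -(fineK finn) lee_fin (le_trans (ler_norm _))// -normrN -sub0r.
  by near: n.
apply/measurable_EFinP.
have mNC : measurable (~` N) by exact: measurableC.
apply: (ae_measurable_fun mu_c (f := EFin \o (fun x => F (f x) * \1_(~` N) x))).
  exists N; split => // x /= h; apply: contrapT => Nx; apply: h => _ /=.
  by rewrite indicE mem_set// mulr1.
apply/measurable_EFinP.
apply: (measurable_fun_cvg (h := fun n x => F (s n x) * \1_(~` N) x)).
  move=> n; apply: measurable_funM; last exact: measurable_indic.
  exact: (simple_function_comp F (ss n)).
move=> x _; rewrite indicE; case: (boolP (x \in ~` N)) => [|_].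
  rewrite inE => Nx /=; rewrite mulr1.
  by under eq_fun do rewrite mulr1; exact: scvg.
by rewrite mulr0; under eq_fun do rewrite mulr0; exact: cvg_cst.
Unshelve. all: by end_near. Qed.

End StrongMeasurability.

Section StrongMeasurabilityLp.
Context (R : realType) (d : measure_display) (T : metricMeasurableType R d).
Variable mu : {measure set T -> \bar R}.
Variables (r : \bar R) (r1 : (1 <= r)%E).
Local Notation X := (lebesgue_space mu r).

Lemma snorm_lebesgue_ge0 (z : T -> R) : (0 <= snorm X z)%E.
Proof. exact: Lnorm_ge0. Qed.

Lemma snorm_lebesgue0 : snorm X 0 = 0%E.
Proof. exact: Lnorm_zero. Qed.

Lemma snorm_lebesgueB (z w : T -> R) : carrier X z -> carrier X w ->
  (snorm X (z - w)%R <= snorm X z + snorm X w)%E.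
Proof.
move=> zX wX; rewrite /= -(LnormN _ _ w); apply: Lnorm_triangle => //.
by rewrite -scaleN1r; exact: LfunZ.
Qed.

Lemma simple_function_sub (s t : T -> T -> R) :
  simple_function X s -> simple_function X t -> simple_function X (s \- t).
Proof.
move=> ss tt; have [fs ms sX] := ss; have [ft mt tX] := tt; split.
- exact: (finite_image11 (fun v w => v - w) fs ft).
- move=> v; rewrite (_ : _ @^-1` _ =
    \bigcup_(w in range s) (s @^-1` [set w] `&` t @^-1` [set w - v])).
    by apply: fin_bigcup_measurable => // w _; exact: measurableI.
  apply/seteqP; split => [x <-|x [w _ [/= -> ->]]]; last by rewrite subKr.
  by exists (s x); [exists x|split => //=; rewrite subKr].
- by move=> x; exact: (LfunB r1 (sX x) (tX x)).
Qed.

Lemma simple_strongly_measurable (s : T -> T -> R) :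
  simple_function X s -> strongly_measurable mu X s.
Proof.
move=> ss; exists (fun=> s) => //; apply: aeW => x.
by under eq_fun do rewrite subrr snorm_lebesgue0; exact: cvg_cst.
Qed.

Lemma strongly_measurable_sub (f g : T -> T -> R) :
  (forall x, carrier X (f x)) -> (forall x, carrier X (g x)) ->
  strongly_measurable mu X f -> strongly_measurable mu X g ->
  strongly_measurable mu X (f \- g).
Proof.
move=> fX gX [s ss sf] [t tt tg]; exists (fun n => s n \- t n).
  by move=> n; exact: simple_function_sub.
apply: filterS2 sf tg => x sx tx.
apply: (@squeeze_cvge _ _ _ _ (cst 0%E) _
  (fun n => snorm X (s n x - f x) + snorm X (t n x - g x))%E).
- apply: nearW => n; rewrite snorm_lebesgue_ge0 /=.
  have -> : (s n \- t n) x - (f \- g) x = (s n x - f x) - (t n x - g x).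
    by rewrite /= !opprD addrACA.
  have [_ _ /(_ x) sX] := ss n; have [_ _ /(_ x) tX] := tt n.
  by apply: snorm_lebesgueB; apply: LfunB => //; [exact: fX|exact: gX].
- exact: cvg_cst.
- by rewrite -[X in _ --> X]adde0; exact: cvgeD.
Qed.

(** The norm is Lipschitz with constant one on its space. *)
Lemma measurable_snorm (f : T -> T -> R) : measure_is_complete mu ->
  (forall x, carrier X (f x)) -> strongly_measurable mu X f ->
  measurable_fun setT (fun x => snorm X (f x)).
Proof.
move=> mu_c fX sf.
rewrite (_ : (fun x => _) = EFin \o ((fun z => fine (snorm X z)) \o f)); last first.
  by apply/funext => x /=; rewrite fineK// (Lfun_fin_num (fX x)).
apply/measurable_EFinP.
apply: (strongly_measurable_comp (c := 1) mu_c _ fX sf) => z w zX wX.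
have le1 (v v' : T -> R) : carrier X v -> carrier X v' ->
    fine (snorm X v) - fine (snorm X v') <= fine (snorm X (v - v')).
  move=> vX v'X; have vBX : v - v' \in Lfun mu r by exact: LfunB.
  rewrite lerBlDr -lee_fin EFinD !fineK ?Lfun_fin_num//.
  by rewrite -[in leLHS](subrK v' v); exact: Lnorm_triangle.
rewrite mul1e -[leRHS]fineK ?lee_fin; last first.
  by rewrite (@Lfun_fin_num _ _ _ mu r)//; exact: LfunB.
rewrite ler_norml le1// andbT lerNl opprB.
by rewrite /= LnormBC; exact: le1.
Qed.

End StrongMeasurabilityLp.

Section Kernels.
Context (R : realType) (d : measure_display) (T : metricMeasurableType R d).
Variable mu : {measure set T -> \bar R}.
Variables (p : \bar R) (p1 : (1 <= p)%E).
Local Notation p' := (hoelder_conjugate p).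
Local Notation Lp := (lebesgue_space mu p).
Local Notation X := (lebesgue_space mu p').
Local Notation K := (integral_operator mu).

Let p'1 : (1 <= p')%E := hoelder_conj_ge1 p1.

(** [pairing mu u] is Lipschitz with constant the norm of [u]. *)
Lemma measurable_integral_operator (J : T -> T -> R) u :
  measure_is_complete mu -> (forall x, carrier X (J x)) ->
  strongly_measurable mu X J -> carrier Lp u ->
  measurable_fun setT (K J u).
Proof.
move=> mu_c JX sJ uL.
apply: (strongly_measurable_comp (F := pairing mu u)
  (c := fine (snorm Lp u)) mu_c _ JX sJ) => z w zX wX.
rewrite fineK ?(Lfun_fin_num uL)// muleC -(pairingBr p1)//.
by apply: pairing_le => //; exact: LfunB.
Qed.

Lemma integral_operator_lincomb (J J' : T -> T -> R) a u :
  (forall x, carrier X (J x)) -> (forall x, carrier X (J' x)) ->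
  carrier Lp u -> K (a *: J + J') u = a *: K J u + K J' u.
Proof.
move=> JX J'X uL; apply/funext => x.
exact: (pairing_lincombr p1 a uL (JX x) (J'X x)).
Qed.

Lemma integral_operatorB (J J' : T -> T -> R) u :
  (forall x, carrier X (J x)) -> (forall x, carrier X (J' x)) ->
  carrier Lp u -> K (J - J') u = K J u - K J' u.
Proof.
by move=> JX J'X uL; apply/funext => x; exact: (pairingBr p1 uL (JX x) (J'X x)).
Qed.

Lemma integral_operator_linear (Y : nspace (T -> R)) (J : T -> T -> R) :
  snorm Y 0 = 0%E -> (forall x, carrier X (J x)) -> linear_on Lp Y (K J).
Proof.
move=> Y0 JX a u v uL vL; rewrite (_ : K J (a *: u + v) = a *: K J u + K J v).
  by rewrite subrr.
by apply/funext => x; exact: (pairing_lincombl p1 a uL vL (JX x)).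
Qed.

(** Common to all target spaces [Y]: a bound of [K J u] by [M] times the norm of
    [u] is all that has to be proved.  [Y] has to give [0] the norm [0], since
    linearity of an operator is expressed by the norm of its defect. *)
Lemma integral_operator_bounded (Y : nspace (T -> R)) (J : T -> T -> R)
    (M : \bar R) : snorm Y 0 = 0%E -> (forall x, carrier X (J x)) ->
  M \is a fin_num -> (0 <= M)%E ->
  (forall u, carrier Lp u -> carrier Y (K J u)) ->
  (forall u, carrier Lp u -> (snorm Y (K J u) <= M * snorm Lp u)%E) ->
  carrier (bounded_operators Lp Y) (K J) /\
  (snorm (bounded_operators Lp Y) (K J) <= M)%E.
Proof.
move=> Y0 JX Mfin M0 KY KM; split.
  split => //; first exact: integral_operator_linear.
  by exists (fine M) => u uL; rewrite fineK//; exact: KM.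
apply: ge_ereal_sup => _ [u [uL u1] <-].
by rewrite (le_trans (KM _ uL))// -[leRHS]mule1 lee_wpmul2l.
Qed.

(** By linearity in the kernel, the norm bound applied to [J' - J] shows that
    the map [K] does not increase distances.  That bound needs [J' - J] to be a
    kernel, whence the hypothesis of stability under differences of finite
    norm. *)
Lemma integral_operator_continuous_linear (Y : nspace (T -> R))
    (kernels : nspace (T -> T -> R)) :
  snorm Y 0 = 0%E ->
  (forall J, carrier kernels J -> forall x, carrier X (J x)) ->
  (forall J J', carrier kernels J -> carrier kernels J' ->
    (snorm kernels (J' - J)%R < +oo)%E -> carrier kernels (J' - J)) ->
  (forall J, carrier kernels J ->
    carrier (bounded_operators Lp Y) (K J) /\
    (snorm (bounded_operators Lp Y) (K J) <= snorm kernels J)%E) ->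
  continuous_linear_map kernels (bounded_operators Lp Y) K.
Proof.
move=> Y0 kX kB kK; split.
- by move=> J /kK[].
- move=> a J J' kJ kJ'; rewrite /= /opnorm.
  have E u : carrier Lp u -> (K (a *: J + J') - (a *: K J + K J')) u = 0.
    move=> uL; change (K (a *: J + J') u - (a *: K J u + K J' u) = 0).
    by rewrite integral_operator_lincomb ?subrr//; exact: kX.
  rewrite (_ : [set _ | _ in _] = [set 0%E]) ?ereal_sup1//.
  apply/seteqP; split => [_ [u [uL _] <-]|_ ->]; first by rewrite E.
  have L0 : carrier Lp 0 by exact: Lfun0.
  by exists 0; [split => //; rewrite /= Lnorm_zero|rewrite E].
- move=> J kJ e e0; exists e => // J' kJ' J'Je.
  have [_ leK] := kK _ (kB _ _ kJ kJ' (lt_trans J'Je (ltry e))).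
  apply: le_lt_trans J'Je; apply: le_trans leK.
  apply: ge_ereal_sup => _ [u [uL u1] <-].
  apply: ereal_sup_ubound; exists u => //.
  congr (snorm Y _); change (K (J' - J) u = K J' u - K J u).
  by rewrite integral_operatorB//; exact: kX.
Qed.

End Kernels.

(** * Kernels in L^q(Omega, L^p') *)

Section BochnerKernels.
Context (R : realType) (d : measure_display) (T : metricMeasurableType R d).
Variable mu : {measure set T -> \bar R}.
Hypothesis mu_c : measure_is_complete mu.
Variables (p q : \bar R) (p1 : (1 <= p)%E) (q1 : (1 <= q)%E).
Local Notation p' := (hoelder_conjugate p).
Local Notation Lp := (lebesgue_space mu p).
Local Notation X := (lebesgue_space mu p').
Local Notation B := (bochner_space mu X q).
Local Notation K := (integral_operator mu).

Let p'1 : (1 <= p')%E := hoelder_conj_ge1 p1.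

Lemma bochner_ge0 (J : T -> T -> R) : (0 <= snorm B J)%E.
Proof. exact: Lnorm_ge0. Qed.

Lemma bochner_fin_num (J : T -> T -> R) : carrier B J -> snorm B J \is a fin_num.
Proof. by case=> _ _ JB; rewrite ge0_fin_numE ?bochner_ge0. Qed.

Lemma bochnerB (J J' : T -> T -> R) : carrier B J -> carrier B J' ->
  (snorm B (J - J')%R < +oo)%E -> carrier B (J - J').
Proof.
move=> [JX sJ _] [J'X sJ' _] JJ'; split => //.
  by move=> x; exact: (LfunB p'1 (JX x) (J'X x)).
exact: strongly_measurable_sub.
Qed.

(** This replaces the extended real function whose norm is taken in the Bochner
    space by a real function, to which the results on [Lfun] apply. *)
Lemma bochner_norm_Lfun (J : T -> T -> R) : carrier B J ->
  (fun x => fine (snorm X (J x))) \in Lfun mu q /\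
  snorm (lebesgue_space mu q) (fun x => fine (snorm X (J x))) = snorm B J.
Proof.
move=> [JX sJ JB].
have E : (fun x => (fine (snorm X (J x)))%:E) = (fun x => snorm X (J x)).
  by apply/funext => x /=; rewrite fineK// (Lfun_fin_num (JX x)).
rewrite /= /comp E; split => //; apply/LfunE; rewrite /comp E; split => //.
by apply/measurable_EFinP; rewrite /comp E; exact: measurable_snorm.
Qed.

(** The $L^q$ norm is taken of Hoelder's inequality at each [x]. *)
Lemma integral_operator_Lfun (J : T -> T -> R) u : carrier B J -> carrier Lp u ->
  K J u \in Lfun mu q /\
  (snorm (lebesgue_space mu q) (K J u) <= snorm B J * snorm Lp u)%E.
Proof.
move=> JB uL; have [JX sJ _] := JB.
have mK : measurable_fun setT (K J u) by exact: (measurable_integral_operator p1).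
have ufin : snorm Lp u \is a fin_num := Lfun_fin_num uL.
have [gL gE] := bochner_norm_Lfun JB; set g := fun x => _ in gL gE.
have leK : (snorm (lebesgue_space mu q) (K J u) <= snorm B J * snorm Lp u)%E.
  have u0 : 0 <= fine (snorm Lp u) by rewrite fine_ge0//; exact: Lnorm_ge0.
  rewrite -gE muleC -(fineK ufin) -[X in X%:E](ger0_norm u0).
  rewrite -(Lnorm_scale _ q1 gL).
  apply: le_Lnorm => //.
  - exact/measurable_EFinP.
  - by apply/measurable_EFinP; exact: Lfun_measurable (LfunZ _ q1 gL).
  - move=> x; rewrite lee_fin.
    apply: le_trans (pairing_fine_le p1 uL (JX x)) _.
    by rewrite mulrC; exact: ler_norm.
split => //; apply/LfunE; split => //.
apply: le_lt_trans leK _.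
by rewrite ltey_eq fin_numM// bochner_fin_num.
Qed.

Lemma lebesgue_operator_bounded (J : T -> T -> R) : carrier B J ->
  carrier (bounded_operators Lp (lebesgue_space mu q)) (K J) /\
  (snorm (bounded_operators Lp (lebesgue_space mu q)) (K J) <= snorm B J)%E.
Proof.
move=> JB; have [JX _ _] := JB.
apply: integral_operator_bounded => //.
- exact: snorm_lebesgue0.
- exact: bochner_fin_num.
- exact: bochner_ge0.
- by move=> u uL; have [] := integral_operator_Lfun JB uL.
- by move=> u uL; have [] := integral_operator_Lfun JB uL.
Qed.

Lemma lebesgue_operator_continuous_linear :
  continuous_linear_map B (bounded_operators Lp (lebesgue_space mu q)) K.
Proof.
apply: (integral_operator_continuous_linear p1).
- exact: snorm_lebesgue0.
- by move=> J [].
- by move=> J J' JB J'B; exact: bochnerB.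
- exact: lebesgue_operator_bounded.
Qed.

End BochnerKernels.

(** * Kernels with continuous images *)

Section ContinuousKernels.
Context (R : realType) (d : measure_display) (T : metricMeasurableType R d).
Variable mu : {measure set T -> \bar R}.
Hypothesis mu_mm : metric_measure mu.
Variables (p : \bar R) (p1 : (1 <= p)%E).
Local Notation p' := (hoelder_conjugate p).
Local Notation Lp := (lebesgue_space mu p).
Local Notation X := (lebesgue_space mu p').
Local Notation B := (bochner_space mu X +oo%E).
Local Notation Cb := (@Cb_space R d T).
Local Notation K := (integral_operator mu).

Let p'1 : (1 <= p')%E := hoelder_conj_ge1 p1.

Lemma Cb_snorm_le (f : T -> R) (M : \bar R) :
  (forall x, (`|f x|%:E <= M)%E) -> (snorm Cb f <= M)%E.
Proof. by move=> fM; apply: ge_ereal_sup => _ [x _ <-]. Qed.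

Lemma Cb_snorm0 : snorm Cb 0 = 0%E.
Proof.
apply/eqP; rewrite eq_le; apply/andP; split.
  by apply: Cb_snorm_le => x; rewrite normr0.
(* [T] is inhabited; over an empty space the supremum would be [-oo] *)
by apply: ereal_sup_ubound; exists point => //; rewrite normr0.
Qed.

Lemma Cb_operator_bounded (J : T -> T -> R) (M : \bar R) :
  (forall x, carrier X (J x)) -> M \is a fin_num -> (0 <= M)%E ->
  (forall u, carrier Lp u -> continuous (K J u)) ->
  (forall u x, carrier Lp u -> (`|K J u x|%:E <= M * snorm Lp u)%E) ->
  carrier (bounded_operators Lp Cb) (K J) /\
  (snorm (bounded_operators Lp Cb) (K J) <= M)%E.
Proof.
move=> JX Mfin M0 Kc KM; apply: integral_operator_bounded => //.
- exact: Cb_snorm0.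
- move=> u uL; split; first exact: Kc.
  have ufin : snorm Lp u \is a fin_num := Lfun_fin_num uL.
  exists (fine (M * snorm Lp u)); split; first exact: num_real.
  move=> c /ltW Mc x _; apply: le_trans Mc.
  by rewrite -lee_fin fineK ?fin_numM//; exact: KM.
- by move=> u uL; apply: Cb_snorm_le => x; exact: KM.
Qed.

(** Continuity at [x0] is Hoelder's inequality for [J x - J x0]. *)
Lemma Cb_vspace_operator_bounded (J : T -> T -> R) :
  carrier (Cb_vspace X) J ->
  carrier (bounded_operators Lp Cb) (K J) /\
  (snorm (bounded_operators Lp Cb) (K J) <= snorm (Cb_vspace X) J)%E.
Proof.
move=> [JX Jc [C JC]].
have leM x : (snorm X (J x) <= snorm (Cb_vspace X) J)%E.
  by apply: ereal_sup_ubound; exists x.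
have M0 : (0 <= snorm (Cb_vspace X) J)%E.
  by apply: le_trans (leM point); exact: snorm_lebesgue_ge0.
apply: Cb_operator_bounded => //.
- rewrite ge0_fin_numE//; apply: (@le_lt_trans _ _ C%:E); last exact: ltry.
  by apply: ge_ereal_sup => _ [x _ <-].
- move=> u uL x0; apply/cvgrPdist_le => e e0.
  have ufin : snorm Lp u \is a fin_num := Lfun_fin_num uL.
  have : (snorm X (J x - J x0)%R * snorm Lp u)%E @[x --> x0] --> 0%E.
    by rewrite -[X in _ --> X](mul0e (snorm Lp u)); apply: cvgeZr => //; exact: Jc.
  move=> /fine_cvgP[finK /cvgrPdist_le/(_ e e0) Ke].
  near=> x; rewrite distrC.
  have -> : K J u x - K J u x0 = pairing mu u (J x - J x0).
    by rewrite (pairingBr p1 uL (JX x) (JX x0)).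
  rewrite -lee_fin; apply: le_trans (pairing_le p1 uL (LfunB p'1 (JX x) (JX x0))) _.
  have finx : (snorm X (J x - J x0)%R * snorm Lp u)%E \is a fin_num by near: x.
  rewrite -(fineK finx) lee_fin (le_trans (ler_norm _))// -normrN -sub0r.
  by near: x.
- move=> u x uL; apply: le_trans (pairing_le p1 uL (JX x)) _.
  by apply: lee_wpmul2r; [exact: Lnorm_ge0|exact: leM].
Unshelve. all: by end_near. Qed.

Lemma Rintegral_pairing_indic (D : set T) (z : T -> R) :
  \int[mu]_(y in D) z y = pairing mu \1_D z.
Proof.
rewrite Rintegral_mkcond; apply: eq_Rintegral => y _.
by rewrite /patch indicE; case: (y \in D); rewrite ?mulr1 ?mulr0.
Qed.

(** Balls have positive measure, so an almost everywhere bound on a continuous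
    function holds everywhere. *)
Lemma ae_le_continuous (f : T -> R) (c : R) : continuous f ->
  {ae mu, forall x, `|f x| <= c} -> forall x, `|f x| <= c.
Proof.
move=> fc [N [mN N0 fN]] x; rewrite leNgt; apply/negP => cfx.
have : \forall y \near x, c < `|f y|.
  have e0 : 0 < `|f x| - c by rewrite subr_gt0.
  have /cvgrPdist_lt/(_ _ e0) := fc x; apply: filterS => y.
  rewrite ltrBrDr -ltrBrDl => /lt_le_trans; apply.
  by rewrite lerBlDl; have := ler_normD (f x - f y) (f y); rewrite subrK.
move=> /nbhs_ballP[r /= r0 xr].
have ballN : ball x r `<=` N.
  by move=> y /xr cfy; apply: fN => /= fy; move: (lt_le_trans cfy fy); rewrite ltxx.
have mball : measurable (ball x r) by apply: (mm_complete mu_mm); exists N.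
have /andP[] := mm_ball mu_mm x r0; rewrite ltNge => /negP[].
by rewrite -N0; apply: le_measure => //; rewrite inE.
Qed.

Section Kernel.
Variable J : T -> T -> R.
Hypothesis JB : carrier B J.
Let JX x : carrier X (J x) := let: And3 JX _ _ := JB in JX x.
Local Notation M := (fine (snorm B J)).

Let M_ge0 : 0 <= M. Proof. by rewrite fine_ge0// bochner_ge0. Qed.

(** Hoelder's inequality with the essential supremum gives the bound for almost
    every [x], and the continuity of [K J u] removes the exception. *)
Lemma continuous_image_le u x : carrier Lp u -> continuous (K J u) ->
  `|K J u x| <= M * fine (snorm Lp u).
Proof.
move=> uL Kc; apply: ae_le_continuous => //.
have [_ gE] := bochner_norm_Lfun (mm_complete mu_mm) p1 JB.
have := Lnormy_ae mu (fun x => fine (snorm X (J x))).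
apply: filterS => y; rewrite -[Lnorm _ _ _]/(snorm (lebesgue_space mu +oo%E) _) gE.
rewrite -[X in (_ <= X)%E]fineK ?(bochner_fin_num JB)// lee_fin => Jy.
apply: le_trans (pairing_fine_le p1 uL (JX y)) _.
apply: ler_wpM2r; first by rewrite fine_ge0// Lnorm_ge0.
exact: le_trans (ler_norm _) Jy.
Qed.

Hypothesis J_test : forall D : set T, measurable D ->
  (mu D < +oo)%E \/ p = +oo%E -> continuous (fun x => \int[mu]_(y in D) J x y).

(** The test sets are exactly the sets whose indicator is in $L^p$, so the
    hypothesis on [J] is what the density principle asks for. *)
Let approx u (e : R) : 0 < e -> carrier Lp u ->
  exists h, [/\ carrier Lp h, continuous (K J h) & (snorm Lp (u - h)%R <= e%:E)%E].
Proof.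
move=> e0 uL; apply: (Lfun_density p1 (P := fun h => continuous (K J h))) => //.
- move=> x; rewrite (_ : K J 0 = cst 0); first exact: cvg_cst.
  apply/funext => y; rewrite /integral_operator.
  by under eq_Rintegral do rewrite mulr0; rewrite /Rintegral integral0.
- move=> D mD D1; have Dfin : (mu D < +oo)%E \/ p = +oo%E by exact/(indic_Lfun mu p1 mD).
  rewrite (_ : K J _ = fun x => \int[mu]_(y in D) J x y); first exact: J_test.
  by apply/funext => x; rewrite Rintegral_pairing_indic.
- move=> a v w vL wL vc wc.
  rewrite (_ : K J _ = fun x => a * K J v x + K J w x); last first.
    by apply/funext => x; exact: (pairing_lincombl p1 a vL wL (JX x)).
  move=> x; apply: cvgD; last exact: wc.
  by apply: cvgM; [exact: cvg_cst|exact: vc].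
Qed.

Let KB u h x : carrier Lp u -> carrier Lp h -> K J (u - h) x = K J u x - K J h x.
Proof.
by move=> uL hL; exact: (pairingBl p1 uL hL (JX x)).
Qed.

(** [u] is approximated by [h] with [K J h] continuous.  The error [K J (u - h) x]
    is controlled at the given [x] by the norm [j] of [J x], which the essential
    supremum [M] need not bound; but [h] may be chosen after [x], with an error
    [a] small with respect to [j]. *)
Lemma kernel_image_le u x : carrier Lp u ->
  `|K J u x| <= M * fine (snorm Lp u).
Proof.
move=> uL; apply/ler_addgt0Pr => e e0.
set j := fine (snorm X (J x)).
have j0 : 0 <= j by rewrite fine_ge0// Lnorm_ge0.
have jM : 0 < j + M + 1 by rewrite ltr_wpDl// addr_ge0.
set a := e / (j + M + 1); have a0 : 0 < a by rewrite divr_gt0.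
have [h [hL hc uh]] := approx a0 uL.
have uhL : carrier Lp (u - h) by exact: LfunB.
have uh' : fine (snorm Lp (u - h)) <= a by rewrite -lee_fin fineK// (Lfun_fin_num uhL).
have h_le : fine (snorm Lp h) <= fine (snorm Lp u) + a.
  apply: le_trans (lerD (lexx _) uh').
  rewrite -lee_fin EFinD !fineK ?(Lfun_fin_num uL) ?(Lfun_fin_num hL)
    ?(Lfun_fin_num uhL)//.
  rewrite [X in (_ + X)%E]/= LnormBC -[in leLHS](subrKC u h).
  by apply: Lnorm_triangle => //; exact: LfunB.
have -> : K J u x = K J (u - h) x + K J h x by rewrite KB// subrK.
apply: le_trans (ler_normD _ _) _.
have e1 : `|K J (u - h) x| <= j * a.
  by apply: le_trans (pairing_fine_le p1 uhL (JX x)) _; rewrite ler_wpM2l.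
have e2 : `|K J h x| <= M * (fine (snorm Lp u) + a).
  by apply: le_trans (continuous_image_le x hL hc) _; rewrite ler_wpM2l.
apply: le_trans (lerD e1 e2) _; rewrite mulrDr addrCA lerD2l -mulrDl.
rewrite /a mulrCA ger_pMr// ler_pdivrMr// mul1r.
by rewrite lerDl.
Qed.

(** [kernel_image_le] applied to [u - h] makes the approximation of [K J u] by the
    continuous functions [K J h] uniform. *)
Lemma kernel_image_continuous u : carrier Lp u -> continuous (K J u).
Proof.
move=> uL x0; apply/cvgrPdist_le => e e0.
have M1 : 0 < M + 1 by rewrite ltr_pwDr.
(* the error is at most [M * a <= e / 3] at both points; adding [1] avoids a
   division by zero when [M = 0] *)
set a := e / 3 / (M + 1).
have a0 : 0 < a by rewrite !divr_gt0.
have [h [hL hc uh]] := approx a0 uL.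
have uhL : carrier Lp (u - h) by exact: LfunB.
have small x : `|K J (u - h) x| <= e / 3.
  apply: le_trans (kernel_image_le x uhL) _.
  apply: (@le_trans _ _ (M * a)).
    by rewrite ler_wpM2l// -lee_fin fineK// (Lfun_fin_num uhL).
  by rewrite /a mulrCA ger_pMr ?divr_gt0// ler_pdivrMr// mul1r lerDl.
have e30 : 0 < e / 3 by rewrite divr_gt0.
have /cvgrPdist_le/(_ _ e30) := hc x0; apply: filterS => x hx.
have -> : K J u x0 - K J u x =
    K J (u - h) x0 + (K J h x0 - K J h x) - K J (u - h) x.
  by rewrite !KB// addrA subrK opprB addrA subrK.
have -> : e = e / 3 + e / 3 + e / 3 by field.
apply: le_trans (ler_normB _ _) _; apply: lerD => //.
by apply: le_trans (ler_normD _ _) _; apply: lerD.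
Qed.

End Kernel.

Local Notation kernels := (continuous_kernel_space mu p).

Lemma continuous_kernel_operator_bounded (J : T -> T -> R) : carrier kernels J ->
  carrier (bounded_operators Lp Cb) (K J) /\
  (snorm (bounded_operators Lp Cb) (K J) <= snorm kernels J)%E.
Proof.
move=> [JB Jt]; have [JX _ _] := JB; apply: Cb_operator_bounded => //.
- exact: bochner_fin_num JB.
- exact: bochner_ge0.
- by move=> u uL; apply: (kernel_image_continuous JB).
- move=> u x uL; have := kernel_image_le JB Jt x uL.
  by rewrite -lee_fin EFinM !fineK// ?(bochner_fin_num JB)// (Lfun_fin_num uL).
Qed.

Lemma continuous_kernelB (J J' : T -> T -> R) :
  carrier kernels J -> carrier kernels J' ->
  (snorm kernels (J' - J)%R < +oo)%E -> carrier kernels (J' - J).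
Proof.
move=> [JB Jt] [J'B J't] JJ'; split; first exact: bochnerB.
have [JX _ _] := JB; have [J'X _ _] := J'B.
move=> D mD Dfin x0; have D1 := (indic_Lfun mu p1 mD).1 Dfin.
have E x : \int[mu]_(y in D) (J' - J) x y =
    \int[mu]_(y in D) J' x y - \int[mu]_(y in D) J x y.
  by rewrite !Rintegral_pairing_indic; exact: (pairingBr p1 D1 (J'X x) (JX x)).
rewrite E (_ : (fun x => _) = fun x =>
    \int[mu]_(y in D) J' x y - \int[mu]_(y in D) J x y); last exact/funext.
by apply: cvgB; [exact: J't|exact: Jt].
Qed.

Lemma continuous_kernel_operator_continuous_linear :
  continuous_linear_map kernels (bounded_operators Lp Cb) K.
Proof.
apply: (integral_operator_continuous_linear p1).
- exact: Cb_snorm0.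
- by move=> J [[]].
- exact: continuous_kernelB.
- exact: continuous_kernel_operator_bounded.
Qed.

End ContinuousKernels.

(** * The Bochner integral *)

(** The sets with a zero coefficient may have infinite measure: [fine] sends this
    measure to [0], and the term vanishes on both sides. *)
Lemma Rintegral_sum_indic d (T : measurableType d) (R : realType)
    (mu : {measure set T -> \bar R}) (I : eqType) (r : seq I) (a : I -> R)
    (A : I -> set T) :
  (forall i, measurable (A i)) ->
  (forall i, a i != 0 -> (mu (A i) < +oo)%E) ->
  mu.-integrable setT (fun x => (\sum_(i <- r) a i * \1_(A i) x)%:E) /\
  \int[mu]_x (\sum_(i <- r) a i * \1_(A i) x) = \sum_(i <- r) a i * fine (mu (A i)).
Proof.
move=> mA Afin.
have int1 i : mu.-integrable setT (fun x => (a i * \1_(A i) x)%:E) /\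
    \int[mu]_x (a i * \1_(A i) x) = a i * fine (mu (A i)).
  have [ai0|ai0] := eqVneq (a i) 0.
    rewrite ai0 mul0r; under eq_fun do rewrite mul0r.
    under eq_Rintegral do rewrite mul0r.
    by split; [exact: integrable0|rewrite /Rintegral integral0].
  have iA : mu.-integrable setT (fun x => (\1_(A i) x)%:E).
    apply/integrableP; split; first exact/measurable_EFinP.
    under eq_integral do rewrite gee0_abs ?lee_fin//.
    by rewrite integral_indic// setIT Afin.
  split; first by under eq_fun do rewrite EFinM; exact: integrableZl.
  by rewrite RintegralZl// /Rintegral integral_indic// setIT.
elim: r => [|i r [IHint IH]].
  under eq_fun do rewrite big_nil; under eq_Rintegral do rewrite big_nil.
  by rewrite big_nil; split; [exact: integrable0|rewrite /Rintegral integral0].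
under eq_fun do rewrite big_cons; under eq_Rintegral do rewrite big_cons.
have [inti ie] := int1 i; split.
  by under eq_fun do rewrite EFinD; exact: integrableD.
by rewrite big_cons RintegralD// ie IH.
Qed.

Section BochnerIntegral.
Context (R : realType) (d : measure_display) (T : metricMeasurableType R d).
Variable mu : {measure set T -> \bar R}.
Hypothesis mu_c : measure_is_complete mu.
Variables (p : \bar R) (p1 : (1 <= p)%E).
Local Notation p' := (hoelder_conjugate p).
Local Notation Lp := (lebesgue_space mu p).
Local Notation X := (lebesgue_space mu p').
Variables (u : T -> R) (uL : carrier Lp u).
Local Notation L := (pairing mu u).

Let p'1 : (1 <= p')%E := hoelder_conj_ge1 p1.

Lemma pairing_sum (I : eqType) (r : seq I) (a : I -> R) (z : I -> T -> R) :
  (forall i, i \in r -> carrier X (z i)) ->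
  carrier X (\sum_(i <- r) a i *: z i) /\
  L (\sum_(i <- r) a i *: z i) = \sum_(i <- r) a i * L (z i).
Proof.
elim: r => [|i r IH] zX.
  by rewrite !big_nil pairingr0; split => //; exact: Lfun0.
have zi : carrier X (z i) by apply: zX; rewrite mem_head.
have [] := IH; first by move=> j jr; apply: zX; rewrite in_cons jr orbT.
move=> SX SE; rewrite !big_cons; split; first exact: Lfun_lincomb.
by rewrite (pairing_lincombr p1)// SE.
Qed.

(** Both sides are the sum of [L v] times the measure of the level set of [v],
    over the values [v] of [s]. *)
Lemma simple_integral_pairing (s : T -> T -> R) : simple_function X s ->
  (forall v, v != 0 -> (mu (s @^-1` [set v]) < +oo)%E) ->
  [/\ carrier X (simple_integral mu s),
    mu.-integrable setT (EFin \o (L \o s)) &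
    \int[mu]_x L (s x) = L (simple_integral mu s)].
Proof.
move=> [fs ms sX] sfin.
pose r := fset_set (range s).
have rX v : v \in r -> carrier X v.
  by rewrite in_fset_set// => /set_mem[x _ <-]; exact: sX.
have [SX SE] := pairing_sum (r := r) (fun v => fine (mu (s @^-1` [set v]))) rX.
have sE : L \o s = fun x => \sum_(v <- r) L v * \1_(s @^-1` [set v]) x.
  apply/funext => x /=; rewrite (bigD1_seq (s x))/= ?fset_uniq//; last first.
    by rewrite in_fset_set//; apply: mem_set; exists x.
  rewrite indicE mem_set// mulr1 big1 ?addr0// => v vs.
  rewrite indicE memNset ?mulr0//= => sv.
  by rewrite sv eqxx in vs.
have Lfin v : L v != 0 -> (mu (s @^-1` [set v]) < +oo)%E.
  by move=> Lv; apply: sfin; apply: contraNneq Lv => ->; rewrite pairingr0.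
have [int_s int_e] := Rintegral_sum_indic r ms Lfin.
rewrite /simple_integral fsbig_finite//; split => //; first by rewrite sE.
rewrite -[LHS]/(\int[mu]_x ((L \o s) x)) sE int_e SE.
by apply: eq_bigr => v _; rewrite mulrC.
Qed.

(** The identity holds for the approximating simple functions [s n].  Passing
    from [s n] to [f] costs at most the norm of [u] times the integral of the
    norm of [f x - s n x] on the left, and times the distance from
    [simple_integral mu (s n)] to [I] on the right; both tend to [0]. *)
Lemma bochner_integral_pairing (f : T -> T -> R) (I : T -> R) :
  (forall x, carrier X (f x)) -> is_bochner_integral mu X f I ->
  \int[mu]_x L (f x) = L I.
Proof.
move=> fX [sf IX [s [ss sfin cvf cvI]]].
have sX n x : carrier X (s n x) by have [_ _] := ss n; apply.
have mLf : measurable_fun setT (L \o f).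
  exact: (measurable_integral_operator p1).
have ufin := Lfun_fin_num uL.
set c := fine (Lnorm mu p (EFin \o u)).
have c0 : 0 <= c by rewrite fine_ge0// Lnorm_ge0.
have LB z w : carrier X z -> carrier X w ->
    (`|L z - L w|%:E <= c%:E * snorm X (z - w)%R)%E.
  move=> zX wX; rewrite -(pairingBr p1)// fineK// muleC; apply: pairing_le => //.
  exact: LfunB.
pose D n := (\int[mu]_x snorm X (f x - s n x)%R)%E.
have mD n : measurable_fun setT (fun x => snorm X (f x - s n x)).
  apply: (@measurable_snorm _ _ _ mu _ p'1 (f \- s n)) => //.
    by move=> x; exact: (LfunB p'1 (fX x) (sX n x)).
  by apply: strongly_measurable_sub => //; exact: simple_strongly_measurable.
have D0 n : (0 <= D n)%E by apply: integral_ge0 => x _; exact: snorm_lebesgue_ge0.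
have mLs n : measurable_fun setT (L \o s n).
  have [_ + _] := simple_integral_pairing (ss n) (sfin n).
  by move/measurable_int/measurable_EFinP.
have leD n : (\int[mu]_x `|L (f x) - L (s n x)|%:E <= c%:E * D n)%E.
  rewrite -ge0_integralZl//; last by move=> x _; exact: snorm_lebesgue_ge0.
  apply: ge0_le_integral => //.
  - apply/measurable_EFinP/measurableT_comp => //.
    exact: (measurable_funB mLf (mLs n)).
  - by apply: measurable_funeM.
  - by move=> x _; exact: LB.
suff Lle : (`|\int[mu]_x L (f x) - L I|%:E <= 0)%E.
  by apply/eqP; rewrite -subr_eq0 -normr_le0 -lee_fin.
have cv0 : (c%:E * (D n + snorm X (simple_integral mu (s n) - I)%R))%E
    @[n --> \oo] --> 0%E.
  rewrite -[X in _ --> X](mule0 c%:E); apply: cvgeZl => //.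
  by rewrite -[X in _ --> X]adde0; exact: cvgeD.
apply: (cvge_to_ge cv0).
have Dfin : \forall n \near \oo, D n \is a fin_num by have /fine_cvgP[] := cvf.
near=> n; have Dn : (D n < +oo)%E by rewrite -ge0_fin_numE//; near: n.
have [SX int_s int_e] := simple_integral_pairing (ss n) (sfin n).
have int_fs : mu.-integrable setT (EFin \o (fun x => L (f x) - L (s n x))).
  apply/integrableP; split.
    exact/measurable_EFinP/(measurable_funB mLf (mLs n)).
  by apply: le_lt_trans (leD n) _; rewrite lte_mul_pinfty.
have int_f : mu.-integrable setT (EFin \o (L \o f)).
  apply: eq_integrable (integrableD _ int_fs int_s) => // x _ /=.
  by rewrite -EFinD subrK.
rewrite muleDr// ?ge0_adde_def ?inE ?snorm_lebesgue_ge0//.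
apply: (@le_trans _ _ (`|\int[mu]_x L (f x) - L (simple_integral mu (s n))|%:E
  + `|L (simple_integral mu (s n)) - L I|%:E)%E).
  by rewrite -EFinD lee_fin; exact: ler_distD.
apply: leeD; last exact: LB.
apply: le_trans (leD n); rewrite -int_e -RintegralB//.
rewrite EFin_normr_Rintegral//; apply: le_abse_integral => //.
exact: measurable_int int_fs.
Unshelve. all: by end_near. Qed.

End BochnerIntegral.

(** * Sobolev kernels *)

(** Nonemptiness matters for [c = 0]: the infimum of the empty set is [+oo], and
    [+oo * 0 = 0] does not bound [a]. *)
Lemma ereal_inf_mul_ge (R : realType) (S : set (\bar R)) (a : \bar R) (c : R) :
  S !=set0 -> 0 <= c -> (forall x, S x -> (a <= x * c%:E)%E) ->
  (a <= ereal_inf S * c%:E)%E.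
Proof.
move=> [x Sx]; rewrite le_eqVlt => /predU1P[<-|c0] aS.
  by rewrite mule0; have := aS _ Sx; rewrite mule0.
rewrite -lee_pdivrMr//; apply: le_ereal_inf_tmp => y Sy.
by rewrite lee_pdivrMr//; exact: aS.
Qed.

Section SobolevOver.
Context (R : realType) (d : measure_display) (T : metricMeasurableType R d).
Context {N : nat} (V : lmodType R) (L : nspace (T -> V)).
Variable is_partial : 'I_N -> (T -> V) -> (T -> V) -> Prop.
Hypothesis L_ge0 : forall f, (0 <= snorm L f)%E.

Local Notation W := (sobolev_over L is_partial).

Definition partial_norm (i : 'I_N) (f : T -> V) : \bar R :=
  ereal_inf [set snorm L g | g in [set g | carrier L g /\ is_partial i f g]].

Lemma sobolev_snormE f : snorm W f = (snorm L f + \sum_(i < N) partial_norm i f)%E.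
Proof. by []. Qed.

Lemma partial_norm_ge0 i f : (0 <= partial_norm i f)%E.
Proof. by apply: le_ereal_inf_tmp => _ [g _ <-]; exact: L_ge0. Qed.

Lemma partial_norm_le i f g : carrier L g -> is_partial i f g ->
  (partial_norm i f <= snorm L g)%E.
Proof. by move=> gL fg; apply: ereal_inf_lbound; exists g. Qed.

Lemma sobolev_ge0 f : (0 <= snorm W f)%E.
Proof. by rewrite sobolev_snormE adde_ge0// sume_ge0// => i _; exact: partial_norm_ge0. Qed.

Lemma sobolev_base_le f : (snorm L f <= snorm W f)%E.
Proof. by rewrite leeDl// sume_ge0// => i _; exact: partial_norm_ge0. Qed.

Lemma sobolev_partial_le i f : (partial_norm i f <= snorm W f)%E.
Proof.
rewrite sobolev_snormE (bigD1 i)//= addeCA leeDl// adde_ge0//.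
by apply: sume_ge0 => j _; exact: partial_norm_ge0.
Qed.

Lemma sobolev_fin_num f : (forall g, carrier L g -> (snorm L g < +oo)%E) ->
  carrier W f -> snorm W f \is a fin_num.
Proof.
move=> L_lty [fL fD]; rewrite ge0_fin_numE ?sobolev_ge0//.
apply: lte_add_pinfty; first exact: L_lty.
apply: lte_sum_pinfty => i _; have [g gL fg] := fD i.
by apply: le_lt_trans (partial_norm_le gL fg) _; exact: L_lty.
Qed.

(** The infimum over the empty set is [+oo], so a finite Sobolev norm
    guarantees that all weak derivatives exist. *)
Lemma sobolev_lty_carrier f : carrier L f -> (snorm W f < +oo)%E -> carrier W f.
Proof.
move=> fL fW; split => // i.
have /ereal_inf_lt[_ [g [gL fg] _] _] := le_lt_trans (sobolev_partial_le i f) fW.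
by exists g.
Qed.

Lemma sobolev_snorm0 : carrier L 0 -> snorm L 0 = 0%E ->
  (forall i, is_partial i 0 0) -> snorm W 0 = 0%E.
Proof.
move=> cL0 L0 d0; apply/eqP; rewrite eq_le sobolev_ge0 andbT.
rewrite sobolev_snormE L0 add0e big1// => i _.
apply/eqP; rewrite eq_le partial_norm_ge0 andbT -L0.
exact: partial_norm_le.
Qed.

End SobolevOver.

Section SobolevKernels.
Context (R : realType) (d : measure_display) (T : metricMeasurableType R d).
Variable mu : {measure set T -> \bar R}.
Hypothesis mu_c : measure_is_complete mu.
Context {N : nat}.
Variables (Omega : set 'rV[R]_N) (iota : T -> 'rV[R]_N).
Variables (p q : \bar R) (p1 : (1 <= p)%E) (q1 : (1 <= q)%E).
Local Notation p' := (hoelder_conjugate p).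
Local Notation Lp := (lebesgue_space mu p).
Local Notation X := (lebesgue_space mu p').
Local Notation B := (bochner_space mu X q).
Local Notation W := (sobolev_space mu Omega iota q).
Local Notation WX := (sobolev_vspace mu Omega iota X q).
Local Notation K := (integral_operator mu).

Let p'1 : (1 <= p')%E := hoelder_conj_ge1 p1.

(** Applying [pairing mu u] to the Bochner integrals [I] and [- I] that define the
    weak derivative [G] of [J] gives opposite real integrals. *)
Lemma integral_operator_weak_partial i (J G : T -> T -> R) u :
  (forall x, carrier X (J x)) -> (forall x, carrier X (G x)) -> carrier Lp u ->
  weak_vpartial mu Omega iota X i J G ->
  weak_partial mu Omega iota i (K J u) (K G u).
Proof.
move=> JX GX uL JG phi tphi; have [I [IJ IG]] := JG phi tphi.
have IX : carrier X I by case: IJ.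
have scaleX (a : T -> R) (f : T -> T -> R) x : carrier X (f x) ->
    carrier X (a x *: f x) by exact: LfunZ.
have EJ : \int[mu]_x (partial i phi (iota x) * K J u x) = pairing mu u I.
  rewrite -(bochner_integral_pairing mu_c p1 uL _ IJ).
    by apply: eq_Rintegral => x _; rewrite (pairingZr p1 _ uL (JX x)).
  by move=> x; exact: (scaleX (fun x => partial i phi (iota x))).
have EG : \int[mu]_x (phi (iota x) * K G u x) = - pairing mu u I.
  have := pairingZr p1 (-1) uL IX; rewrite scaleN1r mulN1r => <-.
  rewrite -(bochner_integral_pairing mu_c p1 uL _ IG).
    by apply: eq_Rintegral => x _; rewrite (pairingZr p1 _ uL (GX x)).
  by move=> x; exact: (scaleX (phi \o iota)).
under eq_Rintegral do rewrite mulrC; rewrite EJ.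
by under eq_Rintegral do rewrite mulrC; rewrite EG opprK.
Qed.

Lemma weak_partial0 i : weak_partial mu Omega iota i 0 0.
Proof.
move=> phi _; under eq_Rintegral do rewrite mul0r.
under [in RHS]eq_Rintegral do rewrite mul0r.
by rewrite /Rintegral integral0 oppr0.
Qed.

(** Each weak derivative [G] of [J] gives the weak derivative [K G u] of [K J u],
    so the infimum that defines the norm of the derivative of [K J u] runs over
    a set containing all these [K G u]. *)
Lemma integral_operator_sobolev (J : T -> T -> R) u : carrier WX J ->
  carrier Lp u ->
  carrier W (K J u) /\ (snorm W (K J u) <= snorm WX J * snorm Lp u)%E.
Proof.
move=> [JB JD] uL; have [JX _ _] := JB.
have KD i G : carrier B G -> weak_vpartial mu Omega iota X i J G ->
    weak_partial mu Omega iota i (K J u) (K G u).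
  by move=> [GX _ _] JG; exact: integral_operator_weak_partial JG.
have [KJL KJn] := integral_operator_Lfun mu_c p1 q1 JB uL.
split.
  split => // i; have [G GB JG] := JD i; exists (K G u); last exact: KD.
  by have [] := integral_operator_Lfun mu_c p1 q1 GB uL.
have n0 := @partial_norm_ge0 _ _ _ N _ B (weak_vpartial mu Omega iota X)
  (@bochner_ge0 _ _ _ mu p q).
rewrite !sobolev_snormE ge0_muleDl ?bochner_ge0//; last first.
  by apply: sume_ge0 => i _; exact: n0.
apply: leeD => //; rewrite ge0_sume_distrl; last by move=> i _; exact: n0.
have ufin : snorm Lp u \is a fin_num := Lfun_fin_num uL.
apply: lee_sum => i _; rewrite -(fineK ufin).
apply: ereal_inf_mul_ge.
- by have [G GB JG] := JD i; exists (snorm B G), G.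
- by rewrite fine_ge0// Lnorm_ge0.
- move=> _ [G [GB JG] <-]; rewrite fineK//.
  have [KGL KGn] := integral_operator_Lfun mu_c p1 q1 GB uL.
  by apply: le_trans KGn; apply: partial_norm_le => //; exact: KD.
Qed.

Lemma sobolev_snorm_zero : snorm W 0 = 0%E.
Proof.
apply: sobolev_snorm0 => //.
- by move=> f; exact: Lnorm_ge0.
- exact: Lfun0.
- exact: snorm_lebesgue0.
- exact: weak_partial0.
Qed.

Lemma sobolev_operator_bounded (J : T -> T -> R) : carrier WX J ->
  carrier (bounded_operators Lp W) (K J) /\
  (snorm (bounded_operators Lp W) (K J) <= snorm WX J)%E.
Proof.
move=> JW; have [[JX _ _] _] := JW.
apply: integral_operator_bounded => //.
- exact: sobolev_snorm_zero.
- apply: sobolev_fin_num => //; first exact: bochner_ge0.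
  by move=> g [].
- by apply: sobolev_ge0; exact: bochner_ge0.
- by move=> u uL; have [] := integral_operator_sobolev JW uL.
- by move=> u uL; have [] := integral_operator_sobolev JW uL.
Qed.

Lemma sobolev_operator_continuous_linear :
  continuous_linear_map WX (bounded_operators Lp W) K.
Proof.
apply: (integral_operator_continuous_linear p1).
- exact: sobolev_snorm_zero.
- by move=> J [[]].
- move=> J J' [JB _] [J'B _] JJ'; apply: sobolev_lty_carrier => //.
    exact: bochner_ge0.
  apply: bochnerB => //; apply: le_lt_trans JJ'.
  by apply: sobolev_base_le; exact: bochner_ge0.
- exact: sobolev_operator_bounded.
Qed.

End SobolevKernels.

(** * The operators with kernel J *)

Theorem proposition3p1 (R : realType) (d : measure_display)
    (T : metricMeasurableType R d) (mu : {measure set T -> \bar R})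
    (mu_mm : metric_measure mu) :
  [/\
    (* (i) *)
    forall p q : \bar R, (1 <= p)%E -> (1 <= q)%E ->
      let Lp := lebesgue_space mu p in
      let Lq := lebesgue_space mu q in
      let kernels :=
        bochner_space mu (lebesgue_space mu (hoelder_conjugate p)) q in
      (forall J : T -> T -> R, (forall x y, 0 <= J x y) -> carrier kernels J ->
         carrier (bounded_operators Lp Lq) (integral_operator mu J) /\
         (snorm (bounded_operators Lp Lq) (integral_operator mu J)
          <= snorm kernels J)%E) /\
      continuous_linear_map kernels (bounded_operators Lp Lq)
        (integral_operator mu),
    (* (ii) *)
    forall p : \bar R, (1 <= p)%E ->
      let Lp := lebesgue_space mu p in
      let Cb := Cb_space in
      let kernels := continuous_kernel_space mu p in
      (forall J : T -> T -> R, (forall x y, 0 <= J x y) -> carrier kernels J ->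
         carrier (bounded_operators Lp Cb) (integral_operator mu J) /\
         (snorm (bounded_operators Lp Cb) (integral_operator mu J)
          <= snorm kernels J)%E) /\
      continuous_linear_map kernels (bounded_operators Lp Cb)
        (integral_operator mu),
    (* (ii), continuous kernels *)
    forall p : \bar R, (1 <= p)%E ->
      let Lp := lebesgue_space mu p in
      let Cb := Cb_space in
      let kernels := Cb_vspace (lebesgue_space mu (hoelder_conjugate p)) in
      forall J : T -> T -> R, (forall x y, 0 <= J x y) -> carrier kernels J ->
        carrier (bounded_operators Lp Cb) (integral_operator mu J) /\
        (snorm (bounded_operators Lp Cb) (integral_operator mu J)
         <= snorm kernels J)%E &
    (* (iii) *)
    forall (N : nat) (Omega : set 'rV[R]_N) (iota : T -> 'rV[R]_N),
      open_euclidean mu Omega iota ->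
      forall p q : \bar R, (1 <= p)%E -> (1 <= q)%E ->
      let Lp := lebesgue_space mu p in
      let Wq := sobolev_space mu Omega iota q in
      let kernels := sobolev_vspace mu Omega iota
        (lebesgue_space mu (hoelder_conjugate p)) q in
      (forall J : T -> T -> R, (forall x y, 0 <= J x y) -> carrier kernels J ->
         carrier (bounded_operators Lp Wq) (integral_operator mu J) /\
         (snorm (bounded_operators Lp Wq) (integral_operator mu J)
          <= snorm kernels J)%E) /\
      continuous_linear_map kernels (bounded_operators Lp Wq)
        (integral_operator mu)].
Proof.
have mu_c := mm_complete mu_mm.
split.
- move=> p q p1 q1 /=; split; last exact: lebesgue_operator_continuous_linear.
  by move=> J _ JB; exact: lebesgue_operator_bounded.
- move=> p p1 /=; split; last exact: continuous_kernel_operator_continuous_linear.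
  by move=> J _ JC; exact: continuous_kernel_operator_bounded.
- by move=> p p1 /= J _ JC; exact: Cb_vspace_operator_bounded.
- move=> N Omega iota _ p q p1 q1 /=.
  split; last exact: sobolev_operator_continuous_linear.
  by move=> J _ JW; exact: sobolev_operator_bounded.
Qed.
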